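(* There exists a $9.38$-competitive algorithm for the preemptive online machine minimization problem when all processing times are equal, i.e. $p_j=p$ for all jobs $j$.
   Context: Machine minimization with deadlines: each job $j$ of a finite instance has integer release date $r_j$, processing time $p_j$ and deadline $d_j$. A feasible preemptive schedule on a given number of identical machines processes each job for $p_j$ units within $[r_j,d_j]$, each machine processing at most one job at a time, no job on two machines at once; preemption and migration allowed. $m$ is the minimum number of machines admitting a feasible schedule. Online: each job becomes known only at its release date, the algorithm makes irrevocable decisions (including opening machines) over time and does not know $m$. An algorithm is $c$-competitive if on every instance it produces a feasible schedule using at most $c\cdot m$ machines. *)

(* Defs.v *)
From HB Require Import structures.
From mathcomp Require Import all_boot all_order all_algebra finmap.
From mathcomp Require Import all_classical all_reals all_analysis.

Set Implicit Arguments.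
Unset Strict Implicit.
Unset Printing Implicit Defensive.

Import Order.TTheory GRing.Theory Num.Theory.

Local Open Scope classical_set_scope.
Local Open Scope ring_scope.

(* The label only serves to tell apart jobs with the same parameters, so that a
   finite set of jobs can represent an arbitrary finite family of jobs. *)
Record job := Job {
  label : nat;
  release : int;
  proc : nat;
  deadline : int }.

Definition job_code (j : job) : nat * int * nat * int :=
  (label j, release j, proc j, deadline j).

Definition job_decode (x : nat * int * nat * int) : job :=
  let: (l, r, p, d) := x in Job l r p d.

Lemma job_codeK : cancel job_code job_decode.
Proof. by case. Qed.

HB.instance Definition _ := Countable.copy job (can_type job_codeK).

Definition instance := {fset job}.

(* Time is real: preemption and migration may occur at any moment.
   [S t i = Some j] means that machine [i] processes job [j] at time [t], and
   [S t i = None] that machine [i] is idle; a machine thus processes at most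
   one job at a time by construction. *)
Definition schedule (R : realType) := R -> nat -> option job.

Record feasible (R : realType) (I : instance) (S : schedule R) : Prop :=
  Feasible {
  feasible_window : forall t i j, S t i = Some j ->
    j \in I /\ (release j)%:~R <= t <= (deadline j)%:~R;
  feasible_no_parallel : forall t i1 i2 j,
    S t i1 = Some j -> S t i2 = Some j -> i1 = i2;
  feasible_measurable : forall i j, measurable [set t | S t i = Some j];
  feasible_amount : forall j, j \in I ->
    lebesgue_measure [set t | exists i, S t i = Some j] = ((proc j)%:R)%:E }.

Definition feasible_on (R : realType) (I : instance) (k : nat)
    (S : schedule R) : Prop :=
  feasible I S /\ forall t i j, S t i = Some j -> (i < k)%N.

(* There is no such [m] exactly when [I] admits no feasible schedule at all. *)
Definition min_machines (R : realType) (I : instance) (m : nat) : Prop :=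
  (exists S : schedule R, feasible_on I m S) /\
  (forall (k : nat) (S : schedule R), feasible_on I k S -> (m <= k)%N).

Definition released (R : realType) (I : instance) (t : R) : instance :=
  [fset j in I | (release j)%:~R <= t]%fset.

(* The first argument of [opened] and [assign] is the set of the jobs released
   up to the current time, the second one is the current time: this is all the
   information available to a deterministic online algorithm, since its past
   decisions are determined by the same data at earlier times. Decisions are
   irrevocable: the assignment at time [t] is fixed by what is known at time
   [t], and an opened machine cannot be closed. *)
Record online_algorithm (R : realType) := OnlineAlgorithm {
  opened : instance -> R -> nat;
  assign : instance -> R -> nat -> option job;
  opened_nondecreasing : forall (I : instance) (s t : R), s <= t ->
    (opened (released I s) s <= opened (released I t) t)%N;
  assign_opened : forall (I : instance) (t : R) (i : nat) (j : job),
    assign (released I t) t i = Some j -> (i < opened (released I t) t)%N }.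

Definition run (R : realType) (A : online_algorithm R) (I : instance) :
    schedule R :=
  fun t => assign A (released I t) t.

(* [opened] is nondecreasing in time, so the bound at every time [t] bounds the
   total number of machines ever opened. *)
Definition competitive (R : realType) (C : instance -> Prop) (c : R)
    (A : online_algorithm R) : Prop :=
  forall (I : instance) (m : nat), C I -> min_machines R I m ->
    feasible I (run A I) /\
    forall t : R, (opened A (released I t) t)%:R <= c * m%:R.

Definition equal_processing_times (I : instance) : Prop :=
  exists p : nat, forall j : job, j \in I -> proc j = p.

(* Main.v *)
Require Import Defs.
From mathcomp Require Import all_boot all_order all_algebra finmap.
From mathcomp Require Import all_classical all_reals all_analysis.
From mathcomp Require Import zify lra.

(** The algorithm below uses at most [7 m] machines.

    Let the load of a set of jobs be the least integer [k] such that, for all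
    integers [a < b], the jobs with window inside [[a, b]] require at most
    [k (b - a)] units of processing; it is a lower bound on [m] that an online
    algorithm can compute and that only grows as jobs are released.

    A tight job (window shorter than [2 p]) is run at once.  The tight jobs
    running at time [t] all have their window inside [[t - p, t + 2 p]], so they
    number at most three times the load.  A loose job contains a full block of
    the grid of mesh [p] that starts at the first release date.  In each block,
    the pending loose jobs with earliest deadlines are run, four times as many
    as the current load.  If a block-deadline [D] were missed, then in some
    period ending at [D] every machine would be busy with the jobs released
    and due within that period.  But [u] blocks before [D] the load accounts
    for the jobs already released in the last [2 u] blocks, whose windows span
    at most [2 u + 2] blocks; a job released [v] blocks before [D] is counted
    for at least [(v + 1) / 2] values of [u], with weight at least
    [4 / (2 v + 2)], so the capacity of the period suffices. *)

Set Implicit Arguments.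
Unset Strict Implicit.
Unset Printing Implicit Defensive.

Import Order.TTheory GRing.Theory Num.Theory.

Local Open Scope nat_scope.

(** * Earliest deadline first in discrete steps with varying capacity *)

Section EarliestDeadlineFirst.
Variables (T : eqType) (b : T -> nat).

Definition edf_pick (c : nat) (P : seq T) : seq T :=
  take c (sort (relpre b leq) P).

Lemma edf_pick_sub c P : {subset edf_pick c P <= P}.
Proof. by move=> j /mem_take; rewrite mem_sort. Qed.

Lemma edf_pick_uniq c P : uniq P -> uniq (edf_pick c P).
Proof. by move=> uP; rewrite take_uniq // sort_uniq. Qed.

Lemma size_edf_pick c P : size (edf_pick c P) <= c.
Proof. by rewrite size_take_min geq_minl. Qed.

(** If some job due by [D] is not picked, it lies in the dropped tail of the sorted list. The prefix
    is then full and holds only deadlines no later than that one. *)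
Lemma edf_pick_saturated c P D :
  size (edf_pick c P) = c /\ {in edf_pick c P, forall j, b j <= D} \/
  {in P, forall j, b j <= D -> j \in edf_pick c P}.
Proof.
set s := sort (relpre b leq) P.
have Ps : pairwise (relpre b leq) s.
  rewrite -sorted_pairwise; last by move=> x y z /=; lia.
  by apply: sort_sorted => x y /=; lia.
have [/hasP[j js /andP[bj jX]]|/hasPn nh] :=
  boolP (has (fun j => (b j <= D) && (j \notin edf_pick c P)) P); last first.
  right=> j jP bj; apply/negPn/negP => jX.
  by have := nh j jP; rewrite bj jX.
left; have jd : j \in drop c s.
  have : j \in s by rewrite mem_sort.
  by rewrite -{1}(cat_take_drop c s) mem_cat (negbTE jX).
split.
  by apply: size_takel; rewrite leqNgt; apply/negP => /ltnW/drop_oversize;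
     move=> E; rewrite E in jd.
move=> x xX; apply: leq_trans bj.
move: Ps; rewrite -(cat_take_drop c s) pairwise_cat => /and3P[/allrelP + _ _].
by apply.
Qed.

Variables (cap : nat -> nat) (avail : nat -> seq T).

Definition edf_step (k : nat) (d : seq T) : seq T :=
  edf_pick (cap k) [seq j <- avail k | j \notin d].

Fixpoint edf_done (k : nat) : seq T :=
  if k is k'.+1 then edf_done k' ++ edf_step k' (edf_done k') else [::].

Definition edf_block (k : nat) : seq T := edf_step k (edf_done k).

Lemma edf_doneP k j :
  reflect (exists2 i, i < k & j \in edf_block i) (j \in edf_done k).
Proof.
elim: k => [|k IHk]; first by constructor=> -[].
rewrite [edf_done _]/= mem_cat; apply: (iffP orP) => [[/IHk[i ik ji]|ji]|].
- by exists i => //; apply: ltnW.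
- by exists k.
- move=> [i]; rewrite ltnS leq_eqVlt => /orP[/eqP-> ji|ik ji]; [by right|left].
  by apply/IHk; exists i.
Qed.

Lemma edf_block_avail k j : j \in edf_block k -> j \in avail k.
Proof. by move/edf_pick_sub; rewrite mem_filter => /andP[]. Qed.

Lemma edf_block_fresh k j : j \in edf_block k -> j \notin edf_done k.
Proof. by move/edf_pick_sub; rewrite mem_filter => /andP[]. Qed.

Lemma edf_block_inj k l j :
  j \in edf_block k -> j \in edf_block l -> k = l.
Proof.
move=> jk jl; case: (ltngtP k l) => // kl.
  by move/negP: (edf_block_fresh jl); case; apply/edf_doneP; exists k.
by move/negP: (edf_block_fresh jk); case; apply/edf_doneP; exists l.
Qed.

Lemma edf_block_uniq k : uniq (avail k) -> uniq (edf_block k).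
Proof. by move=> uk; apply/edf_pick_uniq/filter_uniq. Qed.

Lemma size_edf_block k : size (edf_block k) <= cap k.
Proof. exact: size_edf_pick. Qed.

Variables (J : seq T) (a : T -> nat).
Hypotheses (uJ : uniq J) (availU : forall k, uniq (avail k)).
Hypothesis availE : forall k j, (j \in avail k) = (j \in J) && (a j <= k).

Let backlog D s :=
  [seq j <- J | [&& a j < s, b j <= D & j \notin edf_done s]].

(* The witness [t] is the first step after the last one, before [s], that left
   room for a job due after [D]: no job due by [D] is pending at [t] except
   those that become available then. *)
Lemma edf_backlog D s : exists2 t, t <= s &
  size (backlog D s) + \sum_(t <= k < s) cap k <=
    count (fun j => (t <= a j < s) && (b j <= D)) J.
Proof.
elim: s => [|s [t ts IHs]].
  exists 0 => //; rewrite big_geq // addn0 size_filter.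
  by rewrite (eq_count (a2 := pred0)) ?count_pred0.
have [[szX bX]|all_run] :=
    edf_pick_saturated (cap s) [seq j <- avail s | j \notin edf_done s] D;
  last first.
  exists s.+1 => //; rewrite big_geq // addn0 (_ : backlog D s.+1 = [::]) //.
  apply/eqP; rewrite -size_eq0 size_filter -leqn0 leqNgt -has_count.
  apply/negP => /hasP[j jJ /and3P[aj bj]] /=.
  rewrite mem_cat negb_or => /andP[jd /negP]; apply; apply: all_run => //.
  by rewrite mem_filter jd availE jJ -ltnS.
exists t; first exact: ltnW.
rewrite big_nat_recr //= (addnC (\sum_(_ <= _ < _) _)) addnA.
pose new := [seq j <- J | (a j == s) && (b j <= D)].
(* The [cap s] jobs picked, all due by [D], are disjoint from the next backlog; both come from the
   old backlog or from jobs becoming available exactly at [s]. *)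
have le1 : size (backlog D s.+1) + cap s <= size (backlog D s) + size new.
  rewrite -{1}szX -!size_cat; apply: uniq_leq_size.
    rewrite cat_uniq filter_uniq //= edf_pick_uniq ?filter_uniq // andbT.
    apply/hasPn => j jX; rewrite mem_filter negb_and; apply/orP; left.
    by rewrite /= mem_cat jX orbT !andbF.
  move=> j; rewrite !mem_cat !mem_filter /= => /orP[].
    case/andP=> /and3P[aj bj]; rewrite mem_cat negb_or => /andP[jd _] jJ.
    rewrite bj jJ jd !andbT; lia.
  move=> jX; rewrite (bX _ jX) (edf_block_fresh jX).
  have := edf_block_avail jX; rewrite availE => /andP[-> ]; lia.
have le2 : count (fun j => (t <= a j < s) && (b j <= D)) J + size new <=
    count (fun j => (t <= a j < s.+1) && (b j <= D)) J.
  rewrite size_filter -count_predUI addnC.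
  rewrite (_ : count _ _ = 0) ?add0n; last first.
    rewrite -(count_pred0 J); apply: eq_count => j /=; lia.
  by apply: sub_count => j /=; lia.
lia.
Qed.

(** A job missing its deadline sits in the backlog at [D = s = b j], so by [edf_backlog] the demand
    of some period ending there would strictly exceed its capacity. *)
Lemma edf_meets_deadlines :
  (forall t D, count (fun j => (t <= a j) && (b j <= D)) J <=
     \sum_(t <= k < D) cap k) ->
  {in J, forall j, a j < b j -> j \in edf_done (b j)}.
Proof.
move=> demand j jJ ab; apply/negPn/negP => jd.
have [t _ le] := edf_backlog (b j) (b j).
have : 0 < size (backlog (b j) (b j)).
  rewrite size_filter -has_count; apply/hasP; exists j => //=.
  by rewrite ab leqnn.
have := demand t (b j); set c1 := count _ _.
have : count (fun i => (t <= a i < b j) && (b i <= b j)) J <= c1.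
  by apply: sub_count => i /=; lia.
lia.
Qed.

End EarliestDeadlineFirst.

(** Causality of the rule: this is what lets the blocks be computed online. *)
Lemma eq_edf_block (T : eqType) (b : T -> nat) (c c' : nat -> nat)
    (av av' : nat -> seq T) (k : nat) :
  (forall i, i <= k -> c i = c' i) -> (forall i, i <= k -> av i = av' i) ->
  edf_block b c av k = edf_block b c' av' k.
Proof.
move=> ec eav; rewrite /edf_block.
have -> : edf_done b c av k = edf_done b c' av' k.
  elim: k ec eav => //= k IHk ec eav.
  rewrite IHk => [|i ik|i ik]; try by [apply: ec; lia|apply: eav; lia].
  by rewrite /edf_step ec ?eav //; lia.
by rewrite /edf_step ec ?eav.
Qed.

(** * From load bounds to a bound on the demand of a period *)

Section Doubling.
Local Open Scope ring_scope.

(** With [v = D - a], the admissible indices from [a] on are the first [v./2.+1]. Each contributes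
    at least 2/(v+1), and 2(v/2 + 1) with rounded half is at least v+1. *)
Lemma harmonic_half (t a D : nat) : (t <= a)%N -> (a < D)%N ->
  1 <= \sum_(t <= k < D | ((a <= k) && (D - a <= 2 * (D - k)))%N)
         (2%:R / (D - k).+1%:R : rat).
Proof.
move=> ta aD.
set v := (D - a)%N.
have vD : (a + v./2.+1 <= D)%N by lia.
rewrite (@big_cat_nat _ _ _ a) //=; last by lia.
rewrite (@big_cat_nat _ _ _ (a + v./2.+1)%N _ D) //=; last by lia.
set S1 := \sum_(t <= _ < a | _) _; set S2 := \sum_(a <= _ < _ | _) _.
set S3 := \sum_(_ <= _ < D | _) _.
have S1_0 : 0 <= S1 by apply: sumr_ge0 => k _; rewrite divr_ge0.
have S3_0 : 0 <= S3 by apply: sumr_ge0 => k _; rewrite divr_ge0.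
suff : 1 <= S2 by lra.
rewrite /S2 big_nat_cond.
rewrite (eq_bigl (fun k => (a <= k < a + v./2.+1)%N)); last first.
  move=> k; lia.
rewrite -big_nat.
apply: (@le_trans _ _ (\sum_(a <= k < a + v./2.+1) (2%:R / v.+1%:R : rat))).
  rewrite sumr_const_nat addKn -[leRHS]mulr_natr.
  rewrite mulrAC ler_pdivlMr ?ltr0n // mul1r -natrM ler_nat; lia.
apply: ler_sum_nat => k kk; rewrite ler_pM2l ?lef_pV2 ?posrE ?ltr0n // ler_nat.
lia.
Qed.

(** Double counting: each job collects total weight at least 1 over the indices [k] that count it.
    After exchanging the sums, index [k] pays at most [lb k * 2(D-k+1)] times 2/(D-k+1), whence the
    factor 4. *)
Lemma doubling_demand (T : eqType) (J : seq T) (a b : T -> nat)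
    (lb : nat -> nat) (t D : nat) :
  {in J, forall j, a j < b j}%N ->
  (forall k, (k < D)%N ->
    (count (fun j => [&& a j <= k, b j <= D & D - a j <= 2 * (D - k)]) J <=
       lb k * (2 * (D - k).+1))%N) ->
  (count (fun j => (t <= a j) && (b j <= D)) J <=
     \sum_(t <= k < D) 4 * lb k)%N.
Proof.
move=> ab lbP; rewrite -(ler_nat rat) -sum1_count !natr_sum.
pose w k : rat := 2%:R / (D - k).+1%:R.
have w0 k : 0 <= w k by rewrite divr_ge0.
apply: (@le_trans _ _ (\sum_(j <- J | ((t <= a j) && (b j <= D))%N)
   \sum_(t <= k < D | ((a j <= k) && (D - a j <= 2 * (D - k)))%N) w k)).
  rewrite big_seq_cond [leRHS]big_seq_cond.
  apply: ler_sum => j /and3P[jJ ta bD].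
  by apply: harmonic_half => //; apply: leq_trans bD; apply: ab.
rewrite (exchange_big_dep xpredT) //=.
apply: ler_sum_nat => k /andP[tk kD].
rewrite big_const_seq iter_addr addr0 /= -[leLHS]mulr_natl.
rewrite /w mulrA ler_pdivrMr ?ltr0n // -!natrM ler_nat.
have := lbP k kD.
set c1 := count _ _; set c2 := count _ _.
have : (c2 <= c1)%N by apply: sub_count => j /=; lia.
nia.
Qed.

End Doubling.

Local Open Scope ring_scope.
Local Open Scope classical_set_scope.

(** * The load as a lower bound on the number of machines *)

Definition work (I : instance) (a b : int) : nat :=
  (\sum_(j <- I | (a <= release j)%R && (deadline j <= b)%R) proc j)%N.

Definition load_bound (I : instance) (k : nat) : Prop :=
  forall a b : int, a < b -> (work I a b)%:Z <= k%:Z * (b - a).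

Section Load.
Variable R : realType.
Implicit Types (I : instance) (S : schedule R).

Let mu := @lebesgue_measure R.

Lemma measurable_exists_machine I S j : feasible I S ->
  measurable [set t | exists i, S t i = Some j].
Proof.
move=> fS; rewrite (_ : [set t | _] = \bigcup_i [set t | S t i = Some j]).
  by apply: bigcupT_measurable => i; apply: feasible_measurable fS i j.
by apply/seteqP; split=> t /= [i] => [Si|_ Si]; exists i.
Qed.

(** Jobs with window inside [a, b] are processed only there, and each of the [m] machines is
    available there for measure b - a. *)
Lemma feasible_on_load I m S : feasible_on I m S -> load_bound I m.
Proof.
move=> [fS ltm] a b ab; pose E i j := [set t : R | S t i = Some j].
have mE i j : measurable (E i j) by apply: feasible_measurable fS i j.
pose J := [fset j in I | (a <= release j)%R && (deadline j <= b)%R]%fset.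
have JP j : j \in J -> [/\ j \in I, a <= release j & deadline j <= b].
  by rewrite !inE /= => /andP[-> /andP[]].
have mJ i : measurable (\big[setU/set0]_(j <- J) E i j).
  by rewrite -bigcup_fset; apply: fin_bigcup_measurable.
have leE j : j \in J -> ((proc j)%:R%:E <= \sum_(i < m) mu (E i j))%E.
  move=> /JP[jI _ _]; rewrite -(feasible_amount fS jI).
  have UE : \big[setU/set0]_(i < m) E i j = \bigcup_(i in `I_m) E i j.
    by rewrite (bigcup_mkord m (E ^~ j)).
  have mU : measurable (\big[setU/set0]_(i < m) E i j).
    by rewrite UE; apply: fin_bigcup_measurable.
  apply: (@le_trans _ _ (mu (\big[setU/set0]_(i < m) E i j))); last first.
    by apply: (Boole_inequality mu (A := E ^~ j)) => i _; exact: mE.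
  apply: le_measure; rewrite ?inE; first exact: measurable_exists_machine fS.
    exact: mU.
  by rewrite UE => t [i Si]; exists i => //; exact: ltm Si.
suff : (((work I a b)%:R : R)%:E <= ((m%:Z * (b - a))%:~R : R)%:E)%E.
  by rewrite lee_fin -[_%:R]/((work I a b)%:Z%:~R) ler_int.
have -> : ((work I a b)%:R%:E = \sum_(j <- J) (proc j)%:R%:E :> \bar R)%E.
  rewrite sumEFin -natr_sum /work; congr ((_%:R)%:E).
  by rewrite /J big_fset /=.
have bnd i : (mu (\big[setU/set0]_(j <- J) E i j) <= ((b - a)%:~R)%:E)%E.
  have -> : (((b - a)%:~R : R)%:E = mu `[a%:~R, b%:~R])%E.
    rewrite /mu lebesgue_measure_itv /= lte_fin ltr_int ab -EFinB.
    by rewrite intrD rmorphN.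
  apply: le_measure; rewrite ?inE //; first exact: mJ.
  rewrite -bigcup_fset => t [j /= /JP[_ aj jb] Sj].
  have [_ /andP[rt td]] := feasible_window fS Sj.
  rewrite in_itv /=; apply/andP; split.
    by apply: le_trans rt; rewrite ler_int.
  by apply: le_trans td _; rewrite ler_int.
rewrite big_seq.
apply: le_trans (lee_sum _ (fun j jJ => leE j jJ)) _.
rewrite -big_seq exchange_big /=.
apply: (@le_trans _ _ (\sum_(i < m) ((b - a)%:~R)%:E)%E); last first.
  by rewrite sumEFin sumr_const card_ord lee_fin intrM mulrC -mulr_natr.
apply: lee_sum => i _; apply: le_trans (bnd i).
(* For a fixed machine the sets [E i j] are disjoint, since it runs one job at a time. *)
have -> // : \sum_(j <- J) mu (E i j) = mu (\big[setU/set0]_(j <- J) E i j).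
apply/esym/(@measure_fbigsetU _ _ _ mu _ J (E i)) => [j _|]; first exact: mE.
by move=> j k _ _ [t [jt kt]]; have [] := etrans (esym jt) kt.
Qed.

Lemma feasible_proc_le I S j : feasible I S -> j \in I -> (0 < proc j)%N ->
  (proc j)%:Z <= deadline j - release j.
Proof.
move=> fS jI p0; have A := feasible_amount fS jI.
have : (lebesgue_measure [set t | exists i, S t i = Some j] <=
    mu `[(release j)%:~R, (deadline j)%:~R])%E.
  apply: le_measure; rewrite ?inE //.
    exact: measurable_exists_machine fS.
  by move=> t [i /(feasible_window fS)[_]]; rewrite /= in_itv.
(* A window that is empty or a single point has measure 0, against [0 < proc j]. *)
rewrite A /mu lebesgue_measure_itv /= lte_fin; case: ifP => _.
  rewrite -EFinB lee_fin -rmorphB /= -[_%:R]/((proc j)%:Z%:~R) ler_int //.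
by rewrite lee_fin lern0; lia.
Qed.

(** A countable union of unit intervals. It makes every schedule that depends on time only through
    its floor measurable. *)
Lemma measurable_floor_preimage (Z : set int) :
  measurable [set t : R | Z (Num.floor t)].
Proof.
rewrite (_ : [set t | _] =
    \bigcup_z (if `[< Z z >] then `[z%:~R, (z + 1)%:~R[ else set0)).
  apply: countable_bigcupT_measurable => // z; by case: ifP.
apply/seteqP; split=> t /=.
  move=> Zt; exists (Num.floor t) => //.
  by rewrite asboolT //= in_itv /= floor_itv.
by move=> [z _]; case: asboolP => // Zz /=; rewrite in_itv /= => /floor_def ->.
Qed.

Lemma lebesgue_measure_floor_itv (s : int) (p : nat) :
  lebesgue_measure [set t : R | s <= Num.floor t < s + p%:Z] = (p%:R)%:E.
Proof.
rewrite (_ : [set t | _] = `[s%:~R, (s + p%:Z)%:~R[); last first.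
  by apply/seteqP; split=> t /=; rewrite in_itv /= floor_ge_int floor_lt_int.
rewrite lebesgue_measure_itv /= lte_fin ltr_int.
case: ifP => sp; first by rewrite -EFinB intrD addrAC subrr add0r.
by have -> : p = 0%N by lia.
Qed.

End Load.

Lemma ex_load_bound (I : instance) : exists k, `[< load_bound I k >].
Proof.
exists (\sum_(j <- I) proc j)%N; apply/asboolP => a b ab.
have : (work I a b <= \sum_(j <- I) proc j)%N.
  by rewrite /work big_mkcond leq_sum // => j _; case: ifP.
nia.
Qed.

Definition load (I : instance) : nat := ex_minn (ex_load_bound I).

Lemma loadP (I : instance) : load_bound I (load I).
Proof. by rewrite /load; case: ex_minnP => k /asboolP. Qed.

Lemma load_min (I : instance) (k : nat) : load_bound I k -> (load I <= k)%N.
Proof. by rewrite /load; case: ex_minnP => l _ + Ik; apply; apply/asboolP. Qed.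

Lemma load_sub (I J : instance) : {subset I <= J} -> (load I <= load J)%N.
Proof.
move=> IJ; apply: load_min => a b ab; suff : (work I a b <= work J a b)%N.
  by move=> IJw; have := loadP J ab; apply: le_trans; rewrite lez_nat.
rewrite /work -[leqLHS]big_filter -[leqRHS]big_filter; 
set s := seq.filter _ I; set s' := seq.filter _ J.
have ss' : {subset s <= s'}.
  by move=> j; rewrite !mem_filter => /andP[-> /IJ].
have us : uniq s by rewrite filter_uniq // fset_uniq.
have us' : uniq s' by rewrite filter_uniq // fset_uniq.
have ps' : perm_eq s' (s ++ [seq j <- s' | j \notin s]).
  rewrite -(perm_filterC (mem s) s') perm_cat2r; apply: uniq_perm => //.
    exact: filter_uniq.
  by move=> j; rewrite mem_filter /=; case: (boolP (j \in s)) => //= /ss'.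
by rewrite (perm_big _ ps') big_cat leq_addr.
Qed.

Lemma work_ge (I : instance) (p : nat) (a b : int) (s : seq job) :
  {in I, forall j, proc j = p} -> uniq s ->
  {in s, forall j, [/\ j \in I, a <= release j & deadline j <= b]} ->
  (size s * p <= work I a b)%N.
Proof.
move=> Ip us sP; rewrite /work big_seq_cond.
rewrite (eq_bigr (fun=> p)); last by move=> j /andP[/Ip].
rewrite -big_seq_cond big_const_seq iter_addn_0 mulnC leq_mul2l -size_filter.
apply/orP; right; apply: uniq_leq_size => // j /sP[jI aj jb].
by rewrite mem_filter aj jb jI.
Qed.

Lemma load_ge (I : instance) (p c : nat) (a : int) (s : seq job) :
  (0 < p)%N -> (0 < c)%N -> {in I, forall j, proc j = p} -> uniq s ->
  {in s, forall j, [/\ j \in I, a <= release j &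
                       deadline j <= a + c%:Z * p%:Z]} ->
  (size s <= c * load I)%N.
Proof.
move=> p0 c0 Ip us sP; have := work_ge Ip us sP.
have /(loadP I) : a < a + c%:Z * p%:Z by nia.
set w := work _ _ _; rewrite addrAC subrr add0r => wl sw.
suff : (size s * p <= c * load I * p)%N by rewrite leq_pmul2r.
by apply: leq_trans sw _; rewrite -lez_nat !PoszM (mulrC c%:Z) -mulrA.
Qed.

(** * Information available at integer times *)

Definition known (I : instance) (z : int) : instance :=
  [fset j in I | release j <= z]%fset.

Lemma in_known (I : instance) (z : int) (j : job) :
  (j \in known I z) = (j \in I) && (release j <= z).
Proof. by rewrite !inE. Qed.

Lemma known_known (I : instance) (w z : int) : w <= z ->
  known (known I z) w = known I w.
Proof.
move=> wz; apply/fsetP => j; rewrite !in_known -andbA.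
by congr andb; lia.
Qed.

(** Release dates are integers, so decisions need only change at integer times. *)
Lemma released_floor (R : realType) (I : instance) (t : R) :
  released I t = known I (Num.floor t).
Proof. by apply/fsetP => j; rewrite in_known !inE /= floor_ge_int. Qed.

Definition earliest (I : instance) : job :=
  xget (Job 0 0 0 0)
    [set j | j \in I /\ forall i, i \in I -> release j <= release i].

Lemma earliestP (I : instance) (j : job) : j \in I ->
  earliest I \in I /\ forall i, i \in I -> release (earliest I) <= release i.
Proof.
move=> jI; rewrite /earliest; case: xgetP => [e -> []//|none].
have [e eI eP] : exists2 e, e \in I &
    forall i, i \in I -> release e <= release i.
  have [e _ eP] := @Order.TotalTheory.arg_minP _ _ _ [` jI]%fset xpredT
    (fun i : I => release (val i)) isT.
  by exists (val e) => [|i iI]; [exact: valP|exact: (eP [` iI]%fset isT)].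
by case: (none e).
Qed.

(** Once a job is known, later arrivals cannot be released earlier, so the set of minimizers is
    unchanged and [xget] chooses the same element. The origin of the grid therefore never moves. *)
Lemma earliest_known (I : instance) (z : int) (j : job) :
  j \in known I z -> earliest (known I z) = earliest I.
Proof.
rewrite in_known => /andP[jI jz]; rewrite /earliest; congr xget.
apply/seteqP; split=> e /=; rewrite in_known.
  move=> [/andP[eI ez] eP]; split=> // i iI.
  by have [iz|/ltW zi] := leP (release i) z;
     [apply: eP; rewrite in_known iI|apply: le_trans zi].
move=> [eI eP]; rewrite eI (le_trans (eP j jI) jz); split=> // i.
by rewrite in_known => /andP[/eP].
Qed.

(** * Tight jobs, loose jobs and the block grid *)

Definition loose (p : nat) (j : job) : bool :=
  release j + 2%:Z * p%:Z <= deadline j.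

(* Block [k] of the grid is [r0 + k p, r0 + (k + 1) p); [j] may be processed in
   the blocks [k] with [first_block j <= k < last_block j]. *)
Section Grid.
Variables (p : nat) (r0 : int).

Definition first_block (j : job) : nat :=
  `|((release j - r0 + p%:Z - 1) %/ p%:Z)%Z|%N.
Definition last_block (j : job) : nat := `|((deadline j - r0) %/ p%:Z)%Z|%N.
Definition block_at (z : int) : nat := `|((z - r0) %/ p%:Z)%Z|%N.
Definition block_start (k : nat) : int := r0 + k%:Z * p%:Z.

Definition loose_known (I : instance) (k : nat) : seq job :=
  [seq j <- known I (block_start k) | loose p j].
Definition capacity (I : instance) (k : nat) : nat :=
  4 * load (known I (block_start k)).
Definition block (I : instance) (k : nat) : seq job :=
  edf_block last_block (capacity I) (loose_known I) k.

Definition active (I : instance) (z : int) : seq job :=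
  [seq j <- I | ~~ loose p j & z < release j + p%:Z] ++
  (if r0 <= z then block I (block_at z) else [::]).

Hypothesis p_gt0 : (0 < p)%N.

Lemma first_block_le j k : r0 <= release j ->
  (first_block j <= k)%N = (release j <= block_start k).
Proof.
move=> rj; rewrite /first_block /block_start -lez_nat.
rewrite gez0_abs; last by rewrite divz_ge0 //; lia.
rewrite -(ltzD1 (_ %/ _)%Z) ltz_divLR //; apply/idP/idP; nia.
Qed.

Lemma last_block_ge j k : r0 <= deadline j ->
  (k <= last_block j)%N = (block_start k <= deadline j).
Proof.
move=> dj; rewrite /last_block /block_start -lez_nat.
rewrite gez0_abs; last by rewrite divz_ge0 //; lia.
rewrite lez_divRL //; apply/idP/idP; nia.
Qed.

Lemma block_atE z k : r0 <= z ->
  (block_at z == k) = (block_start k <= z < block_start k + p%:Z).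
Proof.
move=> zr; rewrite /block_at /block_start -eqz_nat.
rewrite gez0_abs; last by rewrite divz_ge0 //; lia.
rewrite eq_le -(ltzD1 (_ %/ _)%Z) ltz_divLR // lez_divRL //; apply/idP/idP; nia.
Qed.

Lemma block_start_at z : r0 <= z -> block_start (block_at z) <= z.
Proof. by move=> zr; have := block_atE (block_at z) zr; rewrite eqxx; lia. Qed.

Lemma first_block_gt j : r0 <= release j ->
  block_start (first_block j) < release j + p%:Z.
Proof.
move=> rj; case E : (first_block j) => [|k]; first by rewrite /block_start; lia.
have := first_block_le k rj; rewrite E ltnn /block_start; nia.
Qed.

(** Rounding the release date up to the grid loses less than [p], so a window of length at least
    [2 p] still contains a whole block. *)
Lemma loose_blocks j : r0 <= release j -> loose p j ->
  (first_block j < last_block j)%N.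
Proof.
rewrite /loose => rj lj; rewrite last_block_ge; last by lia.
by have := first_block_gt rj; rewrite /block_start; nia.
Qed.

Lemma block_known I z k : block_start k <= z -> block (known I z) k = block I k.
Proof.
move=> kz; have le i : (i <= k)%N -> block_start i <= z.
  by rewrite /block_start in kz * => ik; nia.
by apply: eq_edf_block => i /le iz; rewrite /capacity /loose_known known_known.
Qed.

Variable I : instance.
Hypotheses (Ip : {in I, forall j, proc j = p})
  (Ir0 : {in I, forall j, r0 <= release j})
  (Iwin : {in I, forall j, release j + p%:Z <= deadline j}).

Lemma loose_knownE k j :
  (j \in loose_known I k) =
  (j \in [seq j <- I | loose p j]) && (first_block j <= k)%N.
Proof.
rewrite !mem_filter in_known; case: (boolP (j \in I)) => [jI|];
  last by rewrite !andbF.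
by rewrite first_block_le ?Ir0 //= andbT.
Qed.

Lemma loose_demand t D :
  (count (fun j => (t <= first_block j) && (last_block j <= D))%N
     [seq j <- I | loose p j] <= \sum_(t <= k < D) capacity I k)%N.
Proof.
apply: doubling_demand => [j|k kD].
  by rewrite mem_filter => /andP[lj /Ir0 rj]; apply: loose_blocks.
rewrite -size_filter [leqRHS]mulnC.
(* Let u = D - k. A counted job has [first_block] at least k - u and [last_block] at most k + u.
   Rounding hides less than one block at each end, so its window lies within u + 1 blocks on either
   side of [block_start k]. *)
apply: (@load_ge _ p _ (block_start k - ((D - k).+1)%:Z * p%:Z)) => //.
- by move=> j; rewrite in_known => /andP[/Ip].
- by rewrite !filter_uniq // fset_uniq.
move=> j; rewrite !mem_filter => /andP[/and3P[ak bD wk] /andP[lj jI]].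
have rj := Ir0 jI; have dj : r0 <= deadline j by have := Iwin jI; lia.
rewrite in_known jI -first_block_le // ak; split=> //.
  have := first_block_le (first_block j).-1 rj.
  case E : (first_block j) wk => [|f] wk; first by rewrite /block_start; nia.
  by rewrite /= ltnn /block_start; nia.
have := last_block_ge D.+1 dj; rewrite leqNgt ltnS bD /block_start; nia.
Qed.

(** A tight job runs from its release date; a loose one runs throughout the single block that
    earliest deadline first gives it. Membership is tested with the jobs known at [z] only. *)
Lemma active_interval j : j \in I ->
  exists s : int, [/\ release j <= s, s + p%:Z <= deadline j &
    forall z, (j \in active (known I z) z) = (s <= z < s + p%:Z)].
Proof.
move=> jI; have rj := Ir0 jI.
have dj : r0 <= deadline j by have := Iwin jI; lia.
have bE z : r0 <= z -> block (known I z) (block_at z) = block I (block_at z).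
  by move=> rz; apply/block_known/block_start_at.
have lE := loose_knownE.
have availU k : uniq (loose_known I k).
  by rewrite filter_uniq // fset_uniq.
have [lj|tj] := boolP (loose p j); last first.
  exists (release j); split=> //; first exact: Iwin.
  move=> z; rewrite mem_cat mem_filter in_known jI tj /=.
  case: ifP => [rz|_]; last by rewrite orbF andbC.
  have -> : (j \in block (known I z) (block_at z)) = false.
    by apply/negP => /edf_block_avail; rewrite mem_filter (negbTE tj).
  by rewrite orbF andbC.
have jL : j \in [seq j <- I | loose p j] by rewrite mem_filter lj.
have /edf_doneP[k kb jk] := edf_meets_deadlines (filter_uniq _ (fset_uniq I))
  availU lE loose_demand jL (loose_blocks rj lj).
exists (block_start k); split.
- by have := edf_block_avail jk; rewrite lE first_block_le // => /andP[].
- by move: kb; rewrite last_block_ge // /block_start; lia.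
move=> z; rewrite mem_cat mem_filter lj /=.
case: ifP => rz; last by rewrite in_nil /block_start; nia.
rewrite bE // -block_atE //; apply/idP/eqP => [jz|-> //].
exact: edf_block_inj jz jk.
Qed.

Lemma active_uniq z : uniq (active (known I z) z).
Proof.
rewrite cat_uniq filter_uniq ?fset_uniq //=; apply/andP; split.
  case: ifP => //= _; apply/hasPn => j /edf_block_avail.
  by rewrite !mem_filter => /andP[->].
case: ifP => //= _; apply: edf_block_uniq.
by rewrite filter_uniq // fset_uniq.
Qed.

Lemma size_active z : (size (active (known I z) z) <= 7 * load (known I z))%N.
Proof.
rewrite size_cat -[7%N]/(3 + 4)%N mulnDl; apply: leq_add.
  apply: (@load_ge _ p _ (z - p%:Z)) => //.
  - by move=> j; rewrite in_known => /andP[/Ip].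
  - by rewrite filter_uniq // fset_uniq.
  - move=> j; rewrite mem_filter /loose => /andP[/andP[tj zj] jz]; split=> //.
      lia.
    by move: jz; rewrite in_known => /andP[_]; lia.
case: ifP => //= rz; apply: leq_trans (size_edf_block _ _ _ _) _.
rewrite leq_mul2l /=; apply: load_sub => j.
by rewrite [j \in known _ (block_start _)]in_known => /andP[].
Qed.

End Grid.

(** * The online algorithm and its feasibility *)

Definition plan (I : instance) (z : int) : seq job :=
  active (proc (earliest I)) (release (earliest I)) I z.

Lemma plan_sub (I : instance) (z : int) (j : job) : j \in plan I z -> j \in I.
Proof.
rewrite mem_cat => /orP[|]; first by rewrite mem_filter => /andP[].
by case: ifP => // _ /edf_block_avail; rewrite mem_filter in_known => /and3P[].
Qed.

Section Algorithm.
Variable R : realType.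

Definition alg_opened (I : instance) (t : R) : nat := 7 * load I.

(* Machine [i] runs the [i]-th planned job, so a job may migrate whenever the
   plan changes. *)
Definition alg_assign (I : instance) (t : R) (i : nat) : option job :=
  if (i < alg_opened I t)%N then onth (plan I (Num.floor t)) i else None.

Lemma alg_opened_nondecreasing (I : instance) (s t : R) : s <= t ->
  (alg_opened (released I s) s <= alg_opened (released I t) t)%N.
Proof.
move=> st; rewrite leq_mul2l /=; apply: load_sub => j.
by rewrite !inE /= => /andP[-> /le_trans->].
Qed.

Lemma alg_assign_opened (I : instance) (t : R) (i : nat) (j : job) :
  alg_assign (released I t) t i = Some j ->
  (i < alg_opened (released I t) t)%N.
Proof. by rewrite /alg_assign; case: ifP. Qed.

Definition alg : online_algorithm R :=
  OnlineAlgorithm alg_opened_nondecreasing alg_assign_opened.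

Variables (I : instance) (p : nat).
Hypothesis Ip : {in I, forall j, proc j = p}.

Lemma plan_active z :
  plan (known I z) z =
  active p (release (earliest I)) (known I z) z \/ known I z = fset0.
Proof.
have [->|[j jz]] := fset_0Vmem (known I z); [by right|left].
have jI : j \in I by move: jz; rewrite in_known => /andP[].
have [eI _] := earliestP jI.
by rewrite /plan (earliest_known jz) (Ip eI).
Qed.

Lemma plan_interval j : (0 < p)%N ->
  {in I, forall i, release i + p%:Z <= deadline i} -> j \in I ->
  exists s : int, [/\ release j <= s, s + p%:Z <= deadline j &
    forall z, (j \in plan (known I z) z) = (s <= z < s + p%:Z)].
Proof.
move=> p0 Iwin jI.
have Ir0 : {in I, forall i, release (earliest I) <= release i}.
  by have [] := earliestP jI.
have [s [rs sd sP]] := active_interval p0 Ip Ir0 Iwin jI.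
exists s; split=> // z; have [->//|I0] := plan_active z.
(* If nothing is known at [z], then [j] is not yet released, so its interval has not begun. *)
have nz : z < s.
  have : j \notin known I z by rewrite I0.
  by rewrite in_known jI /=; lia.
rewrite (_ : (s <= z < _) = false); last by lia.
by apply/negP => /plan_sub; rewrite I0.
Qed.

Lemma plan_uniq z : uniq (plan (known I z) z).
Proof. exact: active_uniq. Qed.

Lemma size_plan z : (0 < p)%N ->
  (size (plan (known I z) z) <= 7 * load (known I z))%N.
Proof.
move=> p0; have [->|I0] := plan_active z; first exact: size_active.
case E : (plan _ _) => [|j s] //.
have : j \in plan (known I z) z by rewrite E mem_head.
by move/plan_sub; rewrite I0.
Qed.

(** The guard in [alg_assign] is there for arbitrary instances; with equal positive processing times
    the plan always fits on the opened machines, so nothing is cut off. *)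
Lemma run_plan (t : R) i : (0 < p)%N ->
  run alg I t i = onth (plan (known I (Num.floor t)) (Num.floor t)) i.
Proof.
move=> p0; rewrite /run /= /alg_assign released_floor; case: ltnP => // le.
by rewrite onth_default //; apply: leq_trans (size_plan _ p0) _.
Qed.

Lemma run_feasible m (S : schedule R) : feasible_on I m S ->
  feasible I (run alg I).
Proof.
move=> [fS _].
(* For [p = 0] the grid degenerates, but the load is 0: no machine is opened and no processing is
   required. *)
have [p0|p_gt0] := posnP p.
  have run0 t i : run alg I t i = None.
    rewrite /run /= /alg_assign /alg_opened (_ : load _ = 0%N) ?muln0 //.
    apply/eqP; rewrite -leqn0; apply: load_min => a b _.
    rewrite /work big_seq_cond big1 ?mul0r // => j /andP[jI _].
    by rewrite Ip //; move: jI; rewrite released_floor in_known => /andP[].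
  split.
  - by move=> t i j; rewrite run0.
  - by move=> t i k j; rewrite run0.
  - move=> i j; rewrite (_ : [set t | _] = set0) //.
    apply/seteqP; split=> t // St.
    by have : run alg I t i = Some j := St; rewrite run0.
  - move=> j jI; rewrite Ip // p0 (_ : [set t | _] = set0) ?measure0 //.
    apply/seteqP; split=> t // -[i St].
    by have : run alg I t i = Some j := St; rewrite run0.
have Iwin : {in I, forall j, release j + p%:Z <= deadline j}.
  move=> j jI; have := feasible_proc_le fS jI; rewrite Ip // => /(_ p_gt0).
  lia.
have runE t i := run_plan t i p_gt0.
have mem_plan (t : R) j : j \in plan (known I (Num.floor t)) (Num.floor t) <->
    exists i, run alg I t i = Some j.
  split=> [/onthP[i iz]|[i]]; first by exists i; rewrite runE.
  by rewrite runE => iz; apply/onthP; exists i.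
split.
- move=> t i j rj; have jz : j \in plan (known I (Num.floor t)) (Num.floor t).
    by apply/mem_plan; exists i.
  have jI : j \in I by have := plan_sub jz; rewrite in_known => /andP[].
  have [s [rs sd sP]] := plan_interval p_gt0 Iwin jI.
  move: jz; rewrite sP => /andP[sz zs]; split=> //; apply/andP; split.
    by rewrite -floor_ge_int (le_trans rs).
  by apply: ltW; rewrite -floor_lt_int (lt_le_trans zs).
- move=> t i1 i2 j; rewrite !runE => e1 e2; move: (e1); rewrite -e2.
  apply: onth_inj; first exact: plan_uniq.
  by rewrite gtn_min -!onthTE e1 e2.
- move=> i j.
  have -> : [set t | run alg I t i = Some j] =
      [set t | [set z | onth (plan (known I z) z) i = Some j] (Num.floor t)].
    by apply/seteqP; split=> t /=; rewrite -runE.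
  exact: measurable_floor_preimage.
move=> j jI; have [s [_ _ sP]] := plan_interval p_gt0 Iwin jI.
rewrite Ip // -(lebesgue_measure_floor_itv R s p); congr lebesgue_measure.
by apply/seteqP; split=> t /=; rewrite -sP => /mem_plan.
Qed.

End Algorithm.

Theorem theorem10 (R : realType) :
  exists A : online_algorithm R,
    competitive equal_processing_times (938%:R / 100%:R) A.
Proof.
exists (alg R) => I m [p Ip] [[S mS] _]; split.
  exact: (run_feasible Ip mS).
move=> t; rewrite /= /alg_opened released_floor.
(* The load of the known jobs is at most that of [I], hence at most [m]; then 7 is below 9.38. *)
have : (load (known I (Num.floor t)) <= m)%N.
  apply: leq_trans (load_min (feasible_on_load mS)).
  by apply: load_sub => j; rewrite in_known => /andP[].
rewrite -(ler_nat R) natrM; have : 0 <= m%:R :> R by [].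
lra.
Qed.
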